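(* Let $\alpha,\beta>0$ and let $\lambda\in\mathbb{R}$, $a,b>0$. Let $X,Y$ be independent random variables with $X\sim \mathrm{GIG}(\lambda,a,b;\alpha,1)$ and $Y\sim\mathrm{GIG}(-\lambda,a,b;\beta,1)$, and set $(U,V)=H_{III,A}^{\alpha,\beta}(X,Y)$. Then $U$ and $V$ are independent, with $U\sim\mathrm{GIG}(-\lambda,a,b;\alpha,1)$ and $V\sim \mathrm{GIG}(\lambda,a,b;\beta,1)$.
   Context: $\mathbb{R}_+=(0,\infty)$. For $\alpha,\beta>0$ the map $H_{III,A}^{\alpha,\beta}:\mathbb{R}_+^2\to\mathbb{R}_+^2$ is $$H_{III,A}^{\alpha,\beta}(x,y)=\left(\frac{y}{\alpha}\,\frac{\alpha x+\beta y}{x+y},\ \frac{x}{\beta}\,\frac{\alpha x+\beta y}{x+y}\right).$$ For $p,q>0$, $\lambda\in\mathbb{R}$ and $a,b>0$, the generalized inverse Gaussian distribution $\mathrm{GIG}(\lambda,a,b;p,q)$ is the probability distribution on $\mathbb{R}_+$ with density proportional to $x^{\lambda-1}e^{-apx-bqx^{-1}}$, $x\in\mathbb{R}_+$. *)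

(* Defs.v *)
From HB Require Import structures.
From mathcomp Require Import all_boot all_order all_algebra.
From mathcomp Require Import all_classical all_reals all_analysis.
Set Implicit Arguments. Unset Strict Implicit. Unset Printing Implicit Defensive.
Import Order.TTheory GRing.Theory Num.Theory.
Local Open Scope classical_set_scope.
Local Open Scope ring_scope.

Definition gig_dens {R : realType} (lam a b p q : R) (x : R) : R :=
  if 0 < x then x `^ (lam - 1) * expR (- (a * p * x) - b * q / x) else 0.

Definition gig_const {R : realType} (lam a b p q : R) : \bar R :=
  (\int[@lebesgue_measure R]_x (gig_dens lam a b p q x)%:E)%E.

Definition gig_prob {R : realType} (lam a b p q : R) (A : set R) : \bar R :=
  ((fine (gig_const lam a b p q))^-1%:E *
     \int[@lebesgue_measure R]_(x in A) (gig_dens lam a b p q x)%:E)%E.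

Definition has_gig_law {R : realType} {d} {T : measurableType d}
  (P : probability T R) (X : T -> R) (lam a b p q : R) : Prop :=
  measurable_fun setT X /\
  forall A : set R, measurable A -> P (X @^-1` A) = gig_prob lam a b p q A.

Definition indep_rv {R : realType} {d} {T : measurableType d}
  (P : probability T R) (X Y : T -> R) : Prop :=
  measurable_fun setT X /\ measurable_fun setT Y /\
  forall A B : set R, measurable A -> measurable B ->
    P (X @^-1` A `&` Y @^-1` B) = (P (X @^-1` A) * P (Y @^-1` B))%E.

Definition H3A {R : realType} (alpha beta : R) (xy : R * R) : R * R :=
  let: (x, y) := xy in
  (y / alpha * ((alpha * x + beta * y) / (x + y)),
   x / beta * ((alpha * x + beta * y) / (x + y))).

(* Main.v *)
Require Import Defs.
From HB Require Import structures.
From mathcomp Require Import all_boot all_order all_algebra.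
From mathcomp Require Import all_classical all_reals all_analysis.
From mathcomp Require Import measurable_realfun.
From mathcomp Require Import ring.
Set Implicit Arguments.
Unset Strict Implicit.
Unset Printing Implicit Defensive.
Import Order.TTheory GRing.Theory Num.Theory.
Local Open Scope classical_set_scope.
Local Open Scope ring_scope.

(* Write (u, v) = H3A (x, y) with x, y > 0, and r = x / y. Passing successively
   to the coordinates (r, y), (r, u) and (v, u) only rescales one coordinate by
   a factor depending on the other one, so H3A preserves dx dy / (x y), by
   Tonelli and the scaling invariance of dx / x. Since
   alpha u + beta v = alpha x + beta y, 1/u + 1/v = 1/x + 1/y and
   v / u = (alpha x) / (beta y), the joint density of (X, Y) with respect to
   this measure becomes, up to a constant, the product of the two target
   densities; the constants are then fixed by total mass 1. *)

Local Arguments H3A : simpl never.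

(** * Inversion and scaling on the real line *)

(** The power with exponent -1 is the inverse only on nonnegative reals, so it is applied to the
    square of [x]; the extra factor [x] restores the sign. The formula also holds at 0, where the
    inverse is 0 by convention. *)
Lemma measurable_inv (R : realType) : measurable_fun [set: R] (@GRing.inv R).
Proof.
rewrite (_ : GRing.inv = fun x : R => x * (x ^+ 2) `^ (-1)).
  apply: measurable_funM => //.
  apply: (measurableT_comp (f := fun y : R => y `^ (-1))).
    exact: measurable_powR.
  exact: exprn_measurable.
apply/funext => x; rewrite powR_inv1 ?sqr_ge0//.
have [->|x0] := eqVneq x 0; first by rewrite invr0 mul0r.
by rewrite expr2 invfM mulrA divff// mul1r.
Qed.

Lemma measurable_funV d (T : measurableType d) (R : realType) (f : T -> R) :
  measurable_fun setT f -> measurable_fun setT (fun x => (f x)^-1).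
Proof. by move=> mf; exact: (measurableT_comp (@measurable_inv R)). Qed.

(** By uniqueness of Lebesgue measure: [c] times the image of Lebesgue measure under multiplication
    by [c] gives half-open intervals their length. *)
Lemma lebesgue_measure_scale (R : realType) (c : R) (A : set R) : 0 < c ->
  measurable A ->
  (@lebesgue_measure R A = c%:E * lebesgue_measure ((fun x => c * x)%R @^-1` A))%E.
Proof.
move=> c0 mA.
pose phi (x : measurableTypeR R) : measurableTypeR R := c * x.
have mphi : measurable_fun setT phi by exact: mulrl_measurable.
pose phi' : {mfun measurableTypeR R >-> measurableTypeR R} :=
  HB.pack phi (isMeasurableFun.Build _ _ _ _ _ mphi).
pose k : {nonneg R} := NngNum (ltW c0).
rewrite (@lebesgue_measure_unique R (mscale k (pushforward lebesgue_measure phi')))//.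
move=> _ [[a b]] _ <-.
transitivity (c%:E * lebesgue_measure (phi @^-1` `]a, b]))%E; last by [].
rewrite (_ : phi @^-1` _ = `]a / c, b / c]%classic); last first.
  apply/seteqP; split=> x; rewrite /= !in_itv/= /phi.
    by rewrite ltr_pdivrMr// ler_pdivlMr// ![x * _]mulrC.
  by rewrite ltr_pdivrMr// ler_pdivlMr// ![x * _]mulrC.
rewrite !lebesgue_measure_itv/= !lte_fin ltr_pM2r ?invr_gt0//.
case: ifPn => _; last by rewrite mule0.
by rewrite -!EFinB -EFinM -mulrBl mulrC divfK// gt_eqF.
Qed.

Lemma ge0_integral_scale (R : realType) (c : R) (f : R -> \bar R) : 0 < c ->
  measurable_fun setT f -> (forall x, 0 <= f x)%E ->
  (\int[@lebesgue_measure R]_x f x =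
   c%:E * \int[@lebesgue_measure R]_x f (c * x)%R)%E.
Proof.
move=> c0 mf f0.
pose phi (x : measurableTypeR R) : measurableTypeR R := c * x.
have mphi : measurable_fun setT phi by exact: mulrl_measurable.
pose phi' : {mfun measurableTypeR R >-> measurableTypeR R} :=
  HB.pack phi (isMeasurableFun.Build _ _ _ _ _ mphi).
pose k : {nonneg R} := NngNum (ltW c0).
rewrite (@eq_measure_integral _ _ _ _ (mscale k (pushforward lebesgue_measure phi')))/=.
  rewrite ge0_integral_mscale//=; congr (_ * _)%E.
  by rewrite ge0_integral_pushforward.
by move=> A mA _; rewrite (lebesgue_measure_scale c0 mA).
Qed.

(** * The scale-invariant measure dx / x on the positive half-line *)

(** Density of the Haar measure of the multiplicative group of positive reals, extended by 0 so that
    all integrals run over the whole line. *)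
Definition haar_pdf (R : realType) (x : R) : R := if 0 < x then x^-1 else 0.

Lemma haar_pdf_ge0 (R : realType) (x : R) : 0 <= haar_pdf x.
Proof. by rewrite /haar_pdf; case: ifPn => // /ltW; rewrite invr_ge0. Qed.

Lemma measurable_haar_pdf (R : realType) : measurable_fun setT (@haar_pdf R).
Proof.
apply: measurable_fun_ifT => //=; first exact: measurable_fun_ltr.
exact: measurable_inv.
Qed.

Lemma haar_pdfZ (R : realType) (c x : R) : 0 < c ->
  haar_pdf x = c * haar_pdf (c * x).
Proof.
move=> c0; rewrite /haar_pdf pmulr_rgt0//; case: ifPn => // _.
  by rewrite invfM mulrA divff ?gt_eqF// mul1r.
by rewrite mulr0.
Qed.

(** The Jacobian [c] of the substitution cancels against the weight, since [c * haar_pdf (c * x)] is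
    [haar_pdf x]. *)
Lemma haar_integral_scale (R : realType) (c : R) (G : R -> \bar R) : 0 < c ->
  measurable_fun setT G -> (forall x, 0 <= G x)%E ->
  (\int[@lebesgue_measure R]_x ((haar_pdf x)%:E * G (c * x)%R) =
   \int[@lebesgue_measure R]_x ((haar_pdf x)%:E * G x))%E.
Proof.
move=> c0 mG G0.
have mh : measurable_fun setT (fun x => (haar_pdf x)%:E * G x)%E.
  apply: emeasurable_funM => //.
  by apply/measurable_EFinP; exact: measurable_haar_pdf.
rewrite [RHS](ge0_integral_scale c0)//; last first.
  by move=> x; rewrite mule_ge0// lee_fin haar_pdf_ge0.
rewrite -ge0_integralZl//=.
- apply: eq_integral => x _; rewrite muleA -EFinM -haar_pdfZ//.
- apply: (measurableT_comp mh); exact: mulrl_measurable.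
- by move=> x _; rewrite mule_ge0// lee_fin haar_pdf_ge0.
- by rewrite lee_fin ltW.
Qed.

(** The weight vanishes off the positive half-line, so changes of coordinates need checking only at
    positive arguments. *)
Lemma eq_haar_integral (R : realType) (F G : R -> \bar R) :
  (forall x, 0 < x -> F x = G x) ->
  (\int[@lebesgue_measure R]_x ((haar_pdf x)%:E * F x) =
   \int[@lebesgue_measure R]_x ((haar_pdf x)%:E * G x))%E.
Proof.
move=> FG; apply: eq_integral => x _; rewrite /haar_pdf.
by case: ifPn => [/FG -> //|_]; rewrite !mul0e.
Qed.

Lemma haar_fubini (R : realType) (K : R * R -> \bar R) :
  measurable_fun setT K -> (forall z, 0 <= K z)%E ->
  (\int[@lebesgue_measure R]_y ((haar_pdf y)%:E *
     \int[@lebesgue_measure R]_x ((haar_pdf x)%:E * K (x, y))) =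
   \int[@lebesgue_measure R]_x ((haar_pdf x)%:E *
     \int[@lebesgue_measure R]_y ((haar_pdf y)%:E * K (x, y))))%E.
Proof.
move=> mK K0.
have mh := @measurable_haar_pdf R.
have h0 (x : R) : (0 <= (haar_pdf x)%:E)%E by rewrite lee_fin haar_pdf_ge0.
pose L (z : R * R) := ((haar_pdf z.1)%:E * (haar_pdf z.2)%:E * K z)%E.
have mL : measurable_fun setT L.
  apply: emeasurable_funM => //; apply: emeasurable_funM => //;
    apply/measurable_EFinP.
    exact: (measurableT_comp mh measurable_fst).
  exact: (measurableT_comp mh measurable_snd).
have L0 z : (0 <= L z)%E by rewrite !mule_ge0.
transitivity (\int[@lebesgue_measure R]_y \int[@lebesgue_measure R]_x L (x, y))%E.
  apply: eq_integral => y _; rewrite -ge0_integralZl//=.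
  - by apply: eq_integral => x _; rewrite muleA [(_ * (haar_pdf x)%:E)%E]muleC.
  - apply: emeasurable_funM; first exact/measurable_EFinP.
    exact: (measurableT_comp mK (pair2_measurable _)).
  - by move=> x _; rewrite mule_ge0.
rewrite -(fubini_tonelli (m1 := @lebesgue_measure R) (m2 := @lebesgue_measure R))//.
apply: eq_integral => x _; rewrite -ge0_integralZl//=.
- by apply: eq_integral => y _; rewrite muleA.
- apply: emeasurable_funM; first exact/measurable_EFinP.
  exact: (measurableT_comp mK (pair1_measurable _)).
- by move=> y _; rewrite mule_ge0.
Qed.


(** * Invariance of dx dy / (x y) under [H3A] *)

Lemma measurable_H3A (R : realType) (alpha beta : R) :
  measurable_fun setT (H3A alpha beta).
Proof.
have m1 : measurable_fun setT (@fst R R) := measurable_fst.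
have m2 : measurable_fun setT (@snd R R) := measurable_snd.
have ms : measurable_fun setT
    (fun z : R * R => (alpha * z.1 + beta * z.2) / (z.1 + z.2)).
  apply: measurable_funM; last by apply: measurable_funV; exact: measurable_funD.
  by apply: measurable_funD; apply: measurable_funM.
rewrite (_ : H3A alpha beta = fun z =>
  (z.2 / alpha * ((alpha * z.1 + beta * z.2) / (z.1 + z.2)),
   z.1 / beta * ((alpha * z.1 + beta * z.2) / (z.1 + z.2)))); last first.
  by apply/funext => -[].
by apply: measurable_fun_pair; apply: measurable_funM => //;
  apply: measurable_funM.
Qed.

Lemma haar_integral_H3A (R : realType) (alpha beta : R) (K : R * R -> \bar R) :
  0 < alpha -> 0 < beta ->
  measurable_fun setT K -> (forall z, 0 <= K z)%E ->
  (\int[@lebesgue_measure R]_y ((haar_pdf y)%:E *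
     \int[@lebesgue_measure R]_x ((haar_pdf x)%:E * K (H3A alpha beta (x, y)))) =
   \int[@lebesgue_measure R]_y ((haar_pdf y)%:E *
     \int[@lebesgue_measure R]_x ((haar_pdf x)%:E * K (x, y))))%E.
Proof.
move=> a0 b0 mK K0.
have mH := @measurable_H3A R alpha beta.
have m1 : measurable_fun setT (@fst R R) := measurable_fst.
have m2 : measurable_fun setT (@snd R R) := measurable_snd.
(* At fixed [y], substitute x = y r. *)
transitivity (\int[@lebesgue_measure R]_y ((haar_pdf y)%:E *
  \int[@lebesgue_measure R]_r ((haar_pdf r)%:E *
     K (H3A alpha beta (y * r, y)%R))))%E.
  apply: eq_haar_integral => y y0.
  rewrite -(haar_integral_scale (G := fun x => K (H3A alpha beta (x, y))) y0)//.
  apply: (measurableT_comp mK); apply: (measurableT_comp mH).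
  exact: pair2_measurable.
have mK1 : measurable_fun setT
    (fun z : R * R => K (H3A alpha beta (z.2 * z.1, z.2))).
  apply: (measurableT_comp mK); apply: (measurableT_comp mH).
  by apply: measurable_fun_pair => //; exact: measurable_funM.
have /= -> := haar_fubini mK1 (fun=> K0 _).
transitivity (\int[@lebesgue_measure R]_r ((haar_pdf r)%:E *
  \int[@lebesgue_measure R]_u ((haar_pdf u)%:E *
     K (u, alpha / beta * u * r)%R)))%E.
  apply: eq_haar_integral => r r0.
  have s0 : 0 < alpha * r + beta by rewrite addr_gt0// mulr_gt0.
  have r10 : 0 < r + 1 by rewrite addr_gt0.
  (* At fixed [r], the first coordinate of the image of (y r, y) is u = y / c, and the second is
     (alpha / beta) u r. Substituting y = c u therefore makes [u] a coordinate. *)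
  pose c := alpha * (r + 1) / (alpha * r + beta).
  have c0 : 0 < c by rewrite divr_gt0// mulr_gt0.
  rewrite -(haar_integral_scale (G := fun y => K (H3A alpha beta (y * r, y)%R)) c0)//;
      last first.
    apply: (measurableT_comp mK); apply: (measurableT_comp mH).
    by apply: measurable_fun_pair => //; exact: mulrr_measurable.
  apply: eq_haar_integral => u u0; congr (K _).
  have -> : (u, alpha / beta * u * r) = H3A alpha beta (c * u * r, c * u) => //.
  rewrite /H3A /c; congr (_, _); field; rewrite ?gt_eqF//=;
    by rewrite addr_gt0// !mulr_gt0.
have mK2 : measurable_fun setT
    (fun z : R * R => K (z.2, alpha / beta * z.2 * z.1)).
  apply: (measurableT_comp mK); apply: measurable_fun_pair => //.
  by apply: measurable_funM => //; exact: measurable_funM.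
have /= <- := haar_fubini mK2 (fun=> K0 _).
(* At fixed [u], the second coordinate v = (alpha / beta) u r is a rescaling of [r]. *)
transitivity (\int[@lebesgue_measure R]_u ((haar_pdf u)%:E *
  \int[@lebesgue_measure R]_v ((haar_pdf v)%:E * K (u, v)%R)))%E.
  apply: eq_haar_integral => u u0.
  rewrite (haar_integral_scale (G := fun v => K (u, v)))//.
    by rewrite mulr_gt0// divr_gt0.
  exact: (measurableT_comp mK (pair1_measurable _)).
by rewrite haar_fubini.
Qed.

(** * Joint densities of independent variables *)

Section density_measure.
Context d (T : measurableType d) (R : realType).
Variables (mu : {measure set T -> \bar R}) (f : T -> R).
Hypotheses (mf : measurable_fun setT f) (f0 : forall x, 0 <= f x).

(** The two proofs are arguments so that the measure structure, whose axioms rely on them, can be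
    attached to the term itself. *)
Definition density_measure of measurable_fun setT f & (forall x, 0 <= f x) :
  set T -> \bar R := fun A => (\int[mu]_(x in A) (f x)%:E)%E.

Let m := density_measure mf f0.

Let m0 : m set0 = 0%E.
Proof. by rewrite /m /density_measure integral_set0. Qed.

Let m_ge0 A : (0 <= m A)%E.
Proof. by apply: integral_ge0 => x _; rewrite lee_fin. Qed.

Let m_sigma_additive : semi_sigma_additive m.
Proof.
move=> F mF tF mUF; apply: cvg_toP.
  apply: ereal_nondecreasing_is_cvgn => i j ij.
  by apply: lee_sum_nneg_natr => // k _ _; exact: m_ge0.
rewrite /m /density_measure ge0_integral_bigcup//=.
- by apply: measurable_funTS; exact/measurable_EFinP.
- by move=> x _; rewrite lee_fin.
Qed.

HB.instance Definition _ := isMeasure.Build _ _ _ (density_measure mf f0)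
  m0 m_ge0 m_sigma_additive.

End density_measure.

Lemma integral_indicM (R : realType) d (T : measurableType d)
    (mu : {measure set T -> \bar R}) (A : set T) (f : T -> R) :
  (\int[mu]_(x in A) (f x)%:E = \int[mu]_x (\1_A x * f x)%:E)%E.
Proof.
rewrite integral_mkcond; apply: eq_integral => x _.
by rewrite patchE indicE; case: ifPn; rewrite ?mul1r ?mul0r.
Qed.

Lemma ge0_integral_prod (R : realType) d1 d2 (T1 : measurableType d1)
    (T2 : measurableType d2) (mu : {measure set T1 -> \bar R})
    (nu : {measure set T2 -> \bar R}) (f : T1 -> R) (g : T2 -> R) :
  measurable_fun setT f -> measurable_fun setT g ->
  (forall x, 0 <= f x) -> (forall y, 0 <= g y) ->
  (\int[nu]_y \int[mu]_x (f x * g y)%:E =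
   (\int[mu]_x (f x)%:E) * (\int[nu]_y (g y)%:E))%E.
Proof.
move=> mf mg f0 g0.
rewrite -ge0_integralZl//=.
- apply: eq_integral => y _; rewrite muleC -ge0_integralZl//=.
  + by apply: eq_integral => x _; rewrite -EFinM mulrC.
  + exact/measurable_EFinP.
  + by move=> x _; rewrite lee_fin.
  + by rewrite lee_fin.
- exact/measurable_EFinP.
- by move=> x _; rewrite lee_fin.
- by apply: integral_ge0 => x _; rewrite lee_fin.
Qed.

(** Independence speaks of rectangles only, whereas the preimage of a rectangle under [H3A] is a
    general measurable set. Uniqueness of the product measure bridges this gap. *)
Lemma indep_joint_density (R : realType) d d1 d2 (T : measurableType d)
    (T1 : measurableType d1) (T2 : measurableType d2) (P : probability T R)
    (mu : {sigma_finite_measure set T1 -> \bar R})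
    (nu : {sigma_finite_measure set T2 -> \bar R})
    (X : T -> T1) (Y : T -> T2) (f : T1 -> R) (g : T2 -> R) :
  measurable_fun setT X -> measurable_fun setT Y ->
  (forall A B, measurable A -> measurable B ->
    P (X @^-1` A `&` Y @^-1` B) = P (X @^-1` A) * P (Y @^-1` B))%E ->
  measurable_fun setT f -> measurable_fun setT g ->
  (forall x, 0 <= f x) -> (forall y, 0 <= g y) ->
  (forall A, measurable A ->
    P (X @^-1` A) = \int[mu]_(x in A) (f x)%:E)%E ->
  (forall A, measurable A ->
    P (Y @^-1` A) = \int[nu]_(x in A) (g x)%:E)%E ->
  forall C : set (T1 * T2), measurable C ->
    (P ((fun t => (X t, Y t)) @^-1` C) =
     \int[nu]_y \int[mu]_x
       (\1_C (x, y) * (f x * g y))%:E)%E.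
Proof.
move=> mX mY indXY mf mg f0 g0 PX PY C mC.
pose X' : {mfun T >-> T1} := HB.pack X (isMeasurableFun.Build _ _ _ _ _ mX).
pose Y' : {mfun T >-> T2} := HB.pack Y (isMeasurableFun.Build _ _ _ _ _ mY).
pose XY t := (X t, Y t).
have mXY : measurable_fun setT XY by exact: measurable_fun_pair.
pose XY' : {mfun T >-> (T1 * T2)%type} :=
  HB.pack XY (isMeasurableFun.Build _ _ _ _ _ mXY).
pose fg (z : T1 * T2) := f z.1 * g z.2.
have mfg : measurable_fun setT fg.
  apply: measurable_funM.
    exact: (measurableT_comp mf measurable_fst).
  exact: (measurableT_comp mg measurable_snd).
have fg0 z : 0 <= fg z by rewrite mulr_ge0.
have fgE D : measurable D ->
    (density_measure (mu \x nu)%E mfg fg0 D =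
     \int[nu]_y \int[mu]_x
       (\1_D (x, y) * (f x * g y))%:E)%E.
  move=> mD; rewrite /density_measure integral_indicM.
  rewrite (fubini_tonelli2 (fun z => (\1_D z * fg z)%:E))//.
    by apply/measurable_EFinP; apply: measurable_funM.
  by move=> z; rewrite lee_fin mulr_ge0.
rewrite -fgE//.
(* Both the density measure and the joint law agree with the product of the marginal laws on
   rectangles, hence everywhere. *)
transitivity ((distribution P X' \x distribution P Y')%E C); last first.
  apply: (product_measure_unique (m' := density_measure _ mfg fg0)) => // A B mA mB.
  apply: (etrans (fgE _ (measurableX mA mB))).
  transitivity (\int[nu]_y \int[mu]_x
    (\1_A x * f x * (\1_B y * g y))%:E)%E.
    apply: eq_integral => y _; apply: eq_integral => x _; congr EFin.
    by rewrite !indicE in_setX -mulnb natrM; ring.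
  rewrite ge0_integral_prod//=.
  - by rewrite -!integral_indicM -PX// -PY.
  - exact: measurable_funM.
  - exact: measurable_funM.
  - by move=> x; rewrite mulr_ge0.
  - by move=> x; rewrite mulr_ge0.
apply/esym; apply: (product_measure_unique (m' := pushforward P XY')) => //.
Qed.

(** * Recovering marginals and independence from a factored law *)

(** Total mass 1 gives k I(T) J(T) = 1 for the full line T, which forces both masses to be finite
    and nonzero and determines [k]. Taking [A] or [B] to be the full line then yields the
    marginals. *)
Lemma factored_law_normalize (R : realType) d (T : measurableType d)
    (P : probability T R) (U V : T -> R) (I J : set R -> \bar R) (k : R) :
  (forall A, 0 <= I A)%E -> (forall A, 0 <= J A)%E ->
  (forall A B, measurable A -> measurable B ->
    P (U @^-1` A `&` V @^-1` B) = k%:E * (I A * J B))%E ->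
  [/\ forall A, measurable A ->
        (P (U @^-1` A) = (fine (I setT))^-1%:E * I A)%E,
      forall B, measurable B ->
        (P (V @^-1` B) = (fine (J setT))^-1%:E * J B)%E
    & forall A B, measurable A -> measurable B ->
        (P (U @^-1` A `&` V @^-1` B) = P (U @^-1` A) * P (V @^-1` B))%E].
Proof.
move=> I0 J0 H.
(* This product is infinite or 0 according to the sign of [k]; it will exclude infinite masses. *)
have kNy : (k%:E * +oo <> 1%:E)%E.
  case: (ltgtP k 0) => [k0|k0|->].
  - by rewrite lt0_muley.
  - by rewrite gt0_muley.
  - by rewrite mul0e => /eqP; rewrite eqe (eq_sym 0) oner_eq0.
have := H _ _ measurableT measurableT.
rewrite !preimage_setT setIT probability_setT => /esym.
have := I0 setT; have := J0 setT.
(* If exactly one mass is infinite, the product of the masses is 0 when the other one vanishes, and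
   +oo otherwise; neither can give 1. *)
case IT : (I setT) => [i| |]//; case JT : (J setT) => [j| |]//; last 2 first.
- move=> _; rewrite lee_fin le_eqVlt => /predU1P[<-|i0].
    by rewrite mul0e mule0 => /eqP; rewrite eqe (eq_sym 0) oner_eq0.
  by rewrite gt0_muley.
- rewrite lee_fin le_eqVlt => /predU1P[<-|j0] _.
    by rewrite !mule0 => /eqP; rewrite eqe (eq_sym 0) oner_eq0.
  by rewrite gt0_mulye.
move=> _ _ /eqP; rewrite -!EFinM eqe => /eqP kij.
have i0 : i != 0 by apply: contra_eq_neq kij => ->; rewrite mul0r mulr0 eq_sym oner_eq0.
have j0 : j != 0 by apply: contra_eq_neq kij => ->; rewrite !mulr0 eq_sym oner_eq0.
have PU A : measurable A -> (P (U @^-1` A) = i^-1%:E * I A)%E.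
  move=> mA; have := H A _ mA measurableT.
  rewrite preimage_setT setIT JT => ->.
  by rewrite [(I A * _)%E]muleC muleA -EFinM; congr (_%:E * _)%E;
    apply: (mulIf i0); rewrite mulVf// -kij; ring.
have PV B : measurable B -> (P (V @^-1` B) = j^-1%:E * J B)%E.
  move=> mB; have := H _ B measurableT mB.
  rewrite preimage_setT setTI IT => ->.
  by rewrite muleA -EFinM; congr (_%:E * _)%E;
    apply: (mulIf j0); rewrite mulVf// -kij; ring.
split => // A B mA mB.
rewrite PU// PV// H// muleACA -EFinM; congr (_%:E * _)%E.
by rewrite -[LHS](mulfK (mulf_neq0 i0 j0)) kij mul1r invfM.
Qed.

(** * GIG densities relative to dx / x *)

(** Relative to dx / x the exponent becomes [lam] instead of [lam - 1]; the cut-off at 0 is left to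
    [haar_pdf]. *)
Definition gig_haar_dens (R : realType) (lam a b p q x : R) : R :=
  x `^ lam * expR (- (a * p * x) - b * q / x).

Lemma gig_densE (R : realType) (lam a b p q x : R) :
  gig_dens lam a b p q x = haar_pdf x * gig_haar_dens lam a b p q x.
Proof.
rewrite /gig_dens /haar_pdf /gig_haar_dens; case: ifPn => x0; last by rewrite mul0r.
by rewrite powRB ?(gt_eqF x0) ?implybT// powRr1 ?ltW//; ring.
Qed.

Lemma gig_haar_dens_ge0 (R : realType) (lam a b p q x : R) :
  0 <= gig_haar_dens lam a b p q x.
Proof. by rewrite mulr_ge0 ?powR_ge0 ?expR_ge0. Qed.

Lemma measurable_gig_haar_dens (R : realType) (lam a b p q : R) :
  measurable_fun setT (gig_haar_dens lam a b p q).
Proof.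
apply: measurable_funM; first exact: measurable_powR.
apply: (measurableT_comp (@measurable_expR R)); apply: measurable_funB.
  by apply: measurableT_comp => //; exact: mulrl_measurable.
by apply: measurable_funM => //; exact: measurable_inv.
Qed.

Lemma gig_dens_ge0 (R : realType) (lam a b p q x : R) :
  0 <= gig_dens lam a b p q x.
Proof. by rewrite gig_densE mulr_ge0 ?haar_pdf_ge0 ?gig_haar_dens_ge0. Qed.

Lemma measurable_gig_dens (R : realType) (lam a b p q : R) :
  measurable_fun setT (gig_dens lam a b p q).
Proof.
rewrite (_ : gig_dens _ _ _ _ _ = fun x => haar_pdf x * gig_haar_dens lam a b p q x).
  apply: measurable_funM; first exact: measurable_haar_pdf.
  exact: measurable_gig_haar_dens.
by apply/funext => x; exact: gig_densE.
Qed.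

(** Moves the normalizing constant into the density, the form expected by [indep_joint_density]. *)
Lemma gig_probE (R : realType) (lam a b p q : R) (A : set R) : measurable A ->
  gig_prob lam a b p q A =
  (\int[@lebesgue_measure R]_(x in A)
    ((fine (gig_const lam a b p q))^-1 * gig_dens lam a b p q x)%:E)%E.
Proof.
move=> mA; rewrite /gig_prob -ge0_integralZl//=.
- by apply: measurable_funTS; apply/measurable_EFinP; exact: measurable_gig_dens.
- by move=> x _; rewrite lee_fin gig_dens_ge0.
- rewrite lee_fin invr_ge0 fine_ge0// integral_ge0// => x _.
  by rewrite lee_fin gig_dens_ge0.
Qed.

Lemma gig_haar_dens_H3A (R : realType) (alpha beta lam a b x y : R) :
  0 < alpha -> 0 < beta -> 0 < x -> 0 < y ->
  gig_haar_dens lam a b alpha 1 x * gig_haar_dens (- lam) a b beta 1 y =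
  (beta / alpha) `^ lam *
    (gig_haar_dens (- lam) a b alpha 1 (H3A alpha beta (x, y)).1 *
     gig_haar_dens lam a b beta 1 (H3A alpha beta (x, y)).2).
Proof.
move=> al0 be0 x0 y0; rewrite /gig_haar_dens.
set u := (H3A _ _ _).1; set v := (H3A _ _ _).2.
have xy0 : 0 < x + y by exact: addr_gt0.
have s0 : 0 < alpha * x + beta * y by rewrite addr_gt0// mulr_gt0.
have u0 : 0 < u by rewrite !(mulr_gt0, invr_gt0).
have v0 : 0 < v by rewrite !(mulr_gt0, invr_gt0).
have pw : x `^ lam * y `^ (- lam) = (beta / alpha) `^ lam * (u `^ (- lam) * v `^ lam).
  (* All exponents are made equal to [lam], so that the claim reduces to the rational identity x u =
     (beta / alpha) v y. *)
  have e : x `^ lam * u `^ lam = (beta / alpha) `^ lam * v `^ lam * y `^ lam.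
    have ba0 : 0 < beta / alpha by exact: divr_gt0.
    have bav0 : 0 < beta / alpha * v by exact: mulr_gt0.
    rewrite -(powRM _ (ltW x0) (ltW u0)) -(powRM _ (ltW ba0) (ltW v0)).
    rewrite -(powRM _ (ltW bav0) (ltW y0)); congr (powR _ lam).
    by rewrite /u /v /H3A/=; field; rewrite !gt_eqF.
  have := powR_gt0 lam u0; have := powR_gt0 lam y0; rewrite !powRN => Y0 U0.
  rewrite -[x `^ _](mulfK (lt0r_neq0 U0)) e; field.
  by rewrite !gt_eqF.
have ex : expR (- (a * alpha * x) - b * 1 / x) * expR (- (a * beta * y) - b * 1 / y) =
    expR (- (a * alpha * u) - b * 1 / u) * expR (- (a * beta * v) - b * 1 / v).
  rewrite -!expRD; congr expR; rewrite /u /v /H3A/=; field.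
  by rewrite !gt_eqF.
by rewrite mulrACA pw ex; ring.
Qed.

Lemma haar_iterated_integral (R : realType) (L : R * R -> R) :
  measurable_fun setT L -> (forall z, 0 <= L z) ->
  (\int[@lebesgue_measure R]_y \int[@lebesgue_measure R]_x
     (haar_pdf x * haar_pdf y * L (x, y))%:E =
   \int[@lebesgue_measure R]_y ((haar_pdf y)%:E *
     \int[@lebesgue_measure R]_x ((haar_pdf x)%:E * (L (x, y))%:E)))%E.
Proof.
move=> mL L0; apply: eq_integral => y _; rewrite -ge0_integralZl//=.
- by apply: eq_integral => x _; rewrite -!EFinM; congr EFin; ring.
- apply/measurable_EFinP; apply: measurable_funM.
    exact: measurable_haar_pdf.
  exact: (measurableT_comp mL (pair2_measurable _)).
- by move=> x _; rewrite lee_fin mulr_ge0 ?haar_pdf_ge0.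
- by rewrite lee_fin haar_pdf_ge0.
Qed.

(** * Joint law of the image and conclusion *)

Lemma gig_H3A_joint (R : realType) d (T : measurableType d)
    (P : probability T R) (alpha beta lam a b : R) (X Y : T -> R) :
  0 < alpha -> 0 < beta -> indep_rv P X Y ->
  has_gig_law P X lam a b alpha 1 ->
  has_gig_law P Y (- lam) a b beta 1 ->
  exists k : R, forall A B, measurable A -> measurable B ->
    (P ((fun t => (H3A alpha beta (X t, Y t)).1) @^-1` A `&`
        (fun t => (H3A alpha beta (X t, Y t)).2) @^-1` B) = k%:E *
      (\int[@lebesgue_measure R]_(x in A) (gig_dens (- lam) a b alpha 1 x)%:E *
       \int[@lebesgue_measure R]_(x in B) (gig_dens lam a b beta 1 x)%:E))%E.
Proof.
move=> al0 be0 [_ [_ indXY]] [mX PX] [mY PY].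
pose c1 := (fine (gig_const lam a b alpha 1))^-1.
pose c2 := (fine (gig_const (- lam) a b beta 1))^-1.
have c_ge0 l p : 0 <= (fine (gig_const l a b p 1))^-1.
  rewrite invr_ge0 fine_ge0// integral_ge0// => x _.
  by rewrite lee_fin gig_dens_ge0.
(* [c1] and [c2] normalize the laws of [X] and [Y]; the power is the factor produced by
   [gig_haar_dens_H3A]. *)
pose k := c1 * c2 * (beta / alpha) `^ lam.
have k0 : 0 <= k by rewrite !mulr_ge0 ?powR_ge0 ?c_ge0.
exists k => A B mA mB.
pose C := H3A alpha beta @^-1` (A `*` B).
have mAB : measurable (A `*` B) by exact: measurableX.
have mC : measurable C.
  by rewrite -[C]setTI; exact: (@measurable_H3A R alpha beta).
(* Chosen so that, at positive arguments, [K] composed with [H3A] is the joint density of (X, Y)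
   relative to dx dy / (x y), cut down to [C]. *)
pose K (z : R * R) : R := \1_(A `*` B) z *
  (k * (gig_haar_dens (- lam) a b alpha 1 z.1 *
        gig_haar_dens lam a b beta 1 z.2)).
have mK : measurable_fun setT K.
  apply: measurable_funM => //.
  apply: measurable_funM => //; apply: measurable_funM.
    exact: (measurableT_comp (@measurable_gig_haar_dens R _ _ _ _ _) measurable_fst).
  exact: (measurableT_comp (@measurable_gig_haar_dens R _ _ _ _ _) measurable_snd).
have K0 z : 0 <= K z by rewrite mulr_ge0// mulr_ge0// mulr_ge0 ?gig_haar_dens_ge0.
have mKH := measurableT_comp mK (@measurable_H3A R alpha beta).
have mEK : measurable_fun setT (EFin \o K) by exact/measurable_EFinP.
rewrite (_ : _ `&` _ = (fun t => (X t, Y t)) @^-1` C)//.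
have fX l p (c : R) : measurable_fun setT (fun x => c * gig_dens l a b p 1 x).
  by apply: measurable_funM => //; exact: measurable_gig_dens.
pose leb : {sigma_finite_measure set (measurableTypeR R) -> \bar R} :=
  @lebesgue_measure R.
rewrite (@indep_joint_density R _ _ _ T _ _ P leb leb X Y
  (fun x => c1 * gig_dens lam a b alpha 1 x)
  (fun y => c2 * gig_dens (- lam) a b beta 1 y))//; last 6 first.
- exact: fX.
- exact: fX.
- by move=> x; rewrite mulr_ge0 ?c_ge0 ?gig_dens_ge0.
- by move=> x; rewrite mulr_ge0 ?c_ge0 ?gig_dens_ge0.
- by move=> D mD; rewrite PX// gig_probE.
- by move=> D mD; rewrite PY// gig_probE.
transitivity (\int[@lebesgue_measure R]_y \int[@lebesgue_measure R]_x
    (haar_pdf x * haar_pdf y * K (H3A alpha beta (x, y)))%:E)%E.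
  apply: eq_integral => y _; apply: eq_integral => x _; congr EFin.
  rewrite !gig_densE.
  (* Off the open positive quadrant both sides vanish through a factor [haar_pdf]. *)
  have [x0|x0] := ltP 0 x; last first.
    by rewrite (_ : haar_pdf x = 0) ?(mul0r, mulr0)// /haar_pdf ltNge x0.
  have [y0|y0] := ltP 0 y; last first.
    by rewrite (_ : haar_pdf y = 0) ?(mul0r, mulr0)// /haar_pdf ltNge y0.
  rewrite /K /k (_ : \1_C (x, y) = \1_(A `*` B) (H3A alpha beta (x, y)))//.
  have := gig_haar_dens_H3A lam a b al0 be0 x0 y0.
  set p := gig_haar_dens _ _ _ _ _ _; set q := gig_haar_dens _ _ _ _ _ _ => e.
  transitivity (\1_(A `*` B) (H3A alpha beta (x, y)) *
    (c1 * c2 * haar_pdf x * haar_pdf y * (p * q))); first by ring.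
  by rewrite e; ring.
(* The invariance of dx dy / (x y) replaces [K] composed with [H3A] by [K], whose integral splits
   into a product. *)
apply: etrans (haar_iterated_integral mKH (fun z => K0 _)) _.
apply: etrans (haar_integral_H3A al0 be0 mEK (fun z => _)) _ => //.
apply: etrans (esym (haar_iterated_integral mK K0)) _.
transitivity (\int[@lebesgue_measure R]_y \int[@lebesgue_measure R]_x
  (\1_A x * (k * gig_dens (- lam) a b alpha 1 x) *
   (\1_B y * gig_dens lam a b beta 1 y))%:E)%E.
  apply: eq_integral => y _; apply: eq_integral => x _; congr EFin.
  by rewrite /K !gig_densE !indicE in_setX -mulnb natrM; ring.
have mind (D : set R) (h : R -> R) : measurable D -> measurable_fun setT h ->
    measurable_fun setT (fun x => \1_D x * h x).
  by move=> mD mh; exact: measurable_funM.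
have ind0 (D : set R) (h : R -> R) : (forall x, 0 <= h x) ->
    forall x, 0 <= \1_D x * h x.
  by move=> h0 x; exact: mulr_ge0.
have dk0 x : 0 <= k * gig_dens (- lam) a b alpha 1 x.
  by rewrite mulr_ge0// gig_dens_ge0.
have d0 x : 0 <= gig_dens lam a b beta 1 x by exact: gig_dens_ge0.
have md : measurable_fun setT (gig_dens lam a b beta 1).
  exact: measurable_gig_dens.
apply: etrans (@ge0_integral_prod R _ _ _ _ leb leb _ _
  (mind A _ mA (fX (- lam) alpha k)) (mind B _ mB md)
  (ind0 A _ dk0) (ind0 B _ d0)) _.
rewrite -!integral_indicM muleA; congr (_ * _)%E.
rewrite -ge0_integralZl//=.
- apply: measurable_funTS; apply/measurable_EFinP.
  exact: measurable_gig_dens.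
- by move=> x _; rewrite lee_fin gig_dens_ge0.
Qed.

Theorem theorem1p1 (R : realType) (d : measure_display) (T : measurableType d)
  (P : probability T R) (alpha beta lam a b : R) (X Y : T -> R) :
  0 < alpha -> 0 < beta -> 0 < a -> 0 < b ->
  indep_rv P X Y ->
  has_gig_law P X lam a b alpha 1 ->
  has_gig_law P Y (- lam) a b beta 1 ->
  let U := fun t => (H3A alpha beta (X t, Y t)).1 in
  let V := fun t => (H3A alpha beta (X t, Y t)).2 in
  [/\ indep_rv P U V,
      has_gig_law P U (- lam) a b alpha 1
    & has_gig_law P V lam a b beta 1].
Proof.
move=> al0 be0 _ _ indXY lX lY U V.
have [k joint] := gig_H3A_joint al0 be0 indXY lX lY.
have [[mX _] [mY _]] := (lX, lY).
have mXY : measurable_fun setT (fun t => (X t, Y t)) by exact: measurable_fun_pair.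
have mUV := measurableT_comp (@measurable_H3A R alpha beta) mXY.
have mU : measurable_fun setT U by exact: (measurableT_comp measurable_fst mUV).
have mV : measurable_fun setT V by exact: (measurableT_comp measurable_snd mUV).
have int_ge0 l p A :
    (0 <= \int[@lebesgue_measure R]_(x in A) (gig_dens l a b p 1 x)%:E)%E.
  by apply: integral_ge0 => x _; rewrite lee_fin gig_dens_ge0.
(* The total masses appearing here are by definition the constants [gig_const] of the two target
   laws, so the marginals have the form [gig_prob]. *)
have [PU PV PUV] := factored_law_normalize (int_ge0 _ _) (int_ge0 _ _) joint.
split; [exact: (conj mU (conj mV PUV))|exact: (conj mU PU)|exact: (conj mV PV)].
Qed.
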